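(* Let $\mathcal{C}$ be a triangulated category that has all small coproducts, and let $P$ be a countably perfect cosuspended (i.e., $P[-1]\subset P$) set of objects of $\mathcal{C}$. Then the strong extension-closure $\mathcal{LO}$ of $P$ and $\mathcal{RO}=P^{\perp}$ give a weighty torsion pair for $\mathcal{C}$ (i.e., $(\mathcal{LO},\mathcal{RO})$ is a torsion pair and $(\mathcal{LO},\mathcal{RO}[-1])$ is a weight structure on $\mathcal{C}$). Moreover, $\mathcal{LO}$ equals the big hull of $P$.
   Context: For a class $S$ of objects: $S^{\perp}=\{Y: \mathcal{C}(X,Y)=0\ \forall X\in S\}$, ${}^{\perp}S=\{Y:\mathcal{C}(Y,X)=0\ \forall X\in S\}$. A morphism $h$ is $P$-null if $\mathcal{C}(M,h)=0$ for all $M\in P$. $P$ is countably perfect if the class of $P$-null morphisms is closed under countable coproducts. A torsion pair for $\mathcal{C}$ is a couple $(\mathcal{LO},\mathcal{RO})$ of classes of objects with $\mathcal{LO}^{\perp}=\mathcal{RO}$, $\mathcal{LO}={}^{\perp}\mathcal{RO}$, and such that every object $M$ fits in a distinguished triangle $L\to M\to R\to L[1]$ with $L\in\mathcal{LO}$, $R\in\mathcal{RO}$. Weight structures: a pair $(\mathcal{C}_{w\le 0},\mathcal{C}_{w\ge 0})$ of classes of objects such that: (i) both are closed under retracts in $\mathcal{C}$; (ii) $\mathcal{C}_{w\le 0}\subset \mathcal{C}_{w\le 0}[1]$ and $\mathcal{C}_{w\ge 0}[1]\subset \mathcal{C}_{w\ge 0}$; (iii) $\mathcal{C}(X,Y)=0$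 for $X\in\mathcal{C}_{w\le 0}$, $Y\in \mathcal{C}_{w\ge 0}[1]$; (iv) every object $M$ fits in a distinguished triangle $LM\to M\to RM\to LM[1]$ with $LM\in\mathcal{C}_{w\le 0}$, $RM\in \mathcal{C}_{w\ge 0}[1]$. For a sequence $Y_0\xrightarrow{\phi_0} Y_1\xrightarrow{\phi_1}\cdots$ the (countable) homotopy colimit $\varinjlim Y_i$ is a cone of the morphism $\coprod_i Y_i\to\coprod_i Y_i$ whose restriction to $Y_i$ is $\mathrm{id}_{Y_i}-\phi_i: Y_i\to Y_i\oplus Y_{i+1}$ (well defined up to non-canonical isomorphism). A class $Q$ is strongly extension-closed if $0\in Q$ and for all sequences with $Y_0\in Q$ and $\mathrm{Cone}(\phi_i)\in Q$ for all $i\ge 0$, all homotopy colimits $\varinjlim Y_i$ belong to $Q$. The strong extension-closure of $P$ is the smallest strongly extension-closed class containing $P$ that is closed under retracts and under small coproducts. Let $\coprod P$ be the closure of $P$ under small coproducts. The naive big hull of $P$ is the class of homotopy colimits of sequences with $Y_0\in\coprod P$ and $\mathrm{Cone}(\phi_i)\in\coprod P$ for all $i\ge 0$; the big hull of $P$ is the closure of the naive big hull under retracts. *)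

(* Defs.v *)
From mathcomp Require Import all_boot ssralg.

Set Implicit Arguments.
Unset Strict Implicit.
Unset Printing Implicit Defensive.

Import GRing.Theory.
Local Open Scope ring_scope.

(* The universe of small types.  Hom groups and the index types of small
   coproducts are small; objects live in an unrelated, possibly larger, one. *)
Definition SmallType := Type.

(* Records the universe constraint that carriers of [zmodType]s are small. *)
Definition small_carrier (V : zmodType) : SmallType := V.

(* Hom groups are [zmodType]s; their choice structure is classically no
   restriction.  Equality of morphisms is Leibniz equality. *)
Record preadditive := Preadditive {
  obj :> Type;
  hom : obj -> obj -> zmodType;
  idm : forall X, hom X X;
  comp : forall X Y Z, hom Y Z -> hom X Y -> hom X Z;
  comp1m : forall X Y (f : hom X Y), comp (idm Y) f = f;
  compm1 : forall X Y (f : hom X Y), comp f (idm X) = f;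
  compA : forall X Y Z W (h : hom Z W) (g : hom Y Z) (f : hom X Y),
    comp h (comp g f) = comp (comp h g) f;
  compDl : forall X Y Z (g g' : hom Y Z) (f : hom X Y),
    comp (g + g') f = comp g f + comp g' f;
  compDr : forall X Y Z (g : hom Y Z) (f f' : hom X Y),
    comp g (f + f') = comp g f + comp g f'
}.

Arguments hom {p} X Y.
Arguments idm {p} X.
Arguments comp {p X Y Z} g f.

Notation "g \oc f" := (comp g f) (at level 40, left associativity).

Record additive_functor (C D : preadditive) := AdditiveFunctor {
  fobj :> C -> D;
  fmap : forall X Y, hom X Y -> hom (fobj X) (fobj Y);
  fmap1 : forall X, fmap (idm X) = idm (fobj X);
  fmapM : forall X Y Z (g : hom Y Z) (f : hom X Y),
    fmap (g \oc f) = fmap g \oc fmap f;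
  fmapD : forall X Y (f f' : hom X Y), fmap (f + f') = fmap f + fmap f'
}.

Arguments fmap {C D} a {X Y} f.

Section Preadditive.

Variable C : preadditive.
Implicit Types (X Y Z S : C) (P Q : C -> Prop).

Definition is_iso X Y (f : hom X Y) : Prop :=
  exists g : hom Y X, g \oc f = idm X /\ f \oc g = idm Y.

Definition isomorphic X Y : Prop := exists f : hom X Y, is_iso f.

Definition retract_of X Y : Prop :=
  exists (i : hom X Y) (r : hom Y X), r \oc i = idm X.

Definition is_zero X : Prop :=
  forall Y, (forall f : hom X Y, f = 0) /\ (forall f : hom Y X, f = 0).

Definition is_biproduct X Y S (i1 : hom X S) (i2 : hom Y S)
    (p1 : hom S X) (p2 : hom S Y) : Prop :=
  [/\ p1 \oc i1 = idm X, p2 \oc i2 = idm Y, p1 \oc i2 = 0, p2 \oc i1 = 0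
    & i1 \oc p1 + i2 \oc p2 = idm S].

Definition is_additive : Prop :=
  (exists Z, is_zero Z) /\
  (forall X Y, exists S (i1 : hom X S) (i2 : hom Y S) (p1 : hom S X)
     (p2 : hom S Y), is_biproduct i1 i2 p1 p2).

Definition is_coproduct (I : Type) (X : I -> C) S (inj : forall i, hom (X i) S)
    : Prop :=
  forall Y (f : forall i, hom (X i) Y),
    exists! h : hom S Y, forall i, h \oc inj i = f i.

Definition has_small_coproducts : Prop :=
  forall (I : SmallType) (X : I -> C),
    exists S (inj : forall i, hom (X i) S), is_coproduct inj.

(* Classes of objects are predicates; a set of objects is one enumerated by a
   small type. *)
Definition is_set_of_objects P : Prop :=
  exists (J : SmallType) (F : J -> C), forall X, P X <-> exists j, F j = X.

Definition closed_under_retracts Q : Prop :=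
  forall X Y, retract_of X Y -> Q Y -> Q X.

Definition closed_under_small_coproducts Q : Prop :=
  forall (I : SmallType) (X : I -> C), (forall i, Q (X i)) ->
  forall S (inj : forall i, hom (X i) S), is_coproduct inj -> Q S.

Definition right_orth P Y : Prop := forall X, P X -> forall f : hom X Y, f = 0.

Definition left_orth P Y : Prop := forall X, P X -> forall f : hom Y X, f = 0.

Definition null P X Y (h : hom X Y) : Prop :=
  forall M, P M -> forall g : hom M X, h \oc g = 0.

(* [countType] includes the finite index types. *)
Definition countably_perfect P : Prop :=
  forall (I : countType) (X Y : I -> C) (h : forall i, hom (X i) (Y i)),
    (forall i, null P (h i)) ->
  forall S (injX : forall i, hom (X i) S) S' (injY : forall i, hom (Y i) S'),
    is_coproduct injX -> is_coproduct injY ->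
  forall H : hom S S', (forall i, H \oc injX i = injY i \oc h i) -> null P H.

Definition coproduct_closure P X : Prop :=
  forall Q, (forall Y, P Y -> Q Y) -> closed_under_small_coproducts Q -> Q X.

End Preadditive.

(* Each [F (G X)] is isomorphic to [X], naturally in [X]. *)
Definition comp_iso_id (C D : preadditive) (F : additive_functor D C)
    (G : additive_functor C D) : Prop :=
  exists eps : forall X : C, hom (F (G X)) X,
    (forall X, is_iso (eps X)) /\
    (forall X Y (f : hom X Y), f \oc eps X = eps Y \oc fmap F (fmap G f)).

(* The suspension [sh] is an autoequivalence with quasi-inverse [unsh]; strict
   automorphisms are a special case.
   [dist u v w] : X -u-> Y -v-> Z -w-> sh X is a distinguished triangle. *)
Record triangulated := Triangulated {
  tri_cat :> preadditive;
  tri_additive : is_additive tri_cat;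
  sh : additive_functor tri_cat tri_cat;
  unsh : additive_functor tri_cat tri_cat;
  unshK : comp_iso_id sh unsh;
  shK : comp_iso_id unsh sh;
  dist : forall X Y Z : tri_cat, hom X Y -> hom Y Z -> hom Z (sh X) -> Prop;
  dist_iso : forall (X Y Z X' Y' Z' : tri_cat)
      (u : hom X Y) (v : hom Y Z) (w : hom Z (sh X))
      (u' : hom X' Y') (v' : hom Y' Z') (w' : hom Z' (sh X'))
      (f : hom X X') (g : hom Y Y') (h : hom Z Z'),
    is_iso f -> is_iso g -> is_iso h ->
    g \oc u = u' \oc f -> h \oc v = v' \oc g -> fmap sh f \oc w = w' \oc h ->
    dist u v w -> dist u' v' w';
  dist_id : forall X Z : tri_cat, is_zero Z ->
    dist (idm X) (0 : hom X Z) (0 : hom Z (sh X));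
  dist_complete : forall (X Y : tri_cat) (u : hom X Y),
    exists (Z : tri_cat) (v : hom Y Z) (w : hom Z (sh X)), dist u v w;
  dist_rotate : forall (X Y Z : tri_cat)
      (u : hom X Y) (v : hom Y Z) (w : hom Z (sh X)),
    dist u v w <-> dist v w (- fmap sh u);
  dist_fill : forall (X Y Z X' Y' Z' : tri_cat)
      (u : hom X Y) (v : hom Y Z) (w : hom Z (sh X))
      (u' : hom X' Y') (v' : hom Y' Z') (w' : hom Z' (sh X'))
      (f : hom X X') (g : hom Y Y'),
    dist u v w -> dist u' v' w' -> g \oc u = u' \oc f ->
    exists h : hom Z Z', h \oc v = v' \oc g /\ fmap sh f \oc w = w' \oc h;
  dist_octahedron : forall (X Y Z X' Y' Z' : tri_cat)
      (u : hom X Y) (j : hom Y Z') (k : hom Z' (sh X))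
      (v : hom Y Z) (l : hom Z X') (i : hom X' (sh Y))
      (m : hom Z Y') (n : hom Y' (sh X)),
    dist u j k -> dist v l i -> dist (v \oc u) m n ->
    exists (f : hom Z' Y') (g : hom Y' X'),
      [/\ dist f g (fmap sh j \oc i),
          f \oc j = m \oc v, n \oc f = k,
          g \oc m = l & i \oc g = fmap sh u \oc n]
}.

Arguments sh {t}.
Arguments unsh {t}.
Arguments dist {t X Y Z} u v w.

Section Triangulated.

Variable C : triangulated.
Implicit Types (X Y Z L R M : C) (P Q LO RO : C -> Prop).

(* Cones, hence also homotopy colimits, are determined only up to isomorphism,
   so being one is a relation; ``Cone f belongs to Q'' means that Q contains
   some cone of f. *)
Definition is_cone X Y (f : hom X Y) Z : Prop :=
  exists (v : hom Y Z) (w : hom Z (sh X)), dist f v w.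

Definition cone_in Q X Y (f : hom X Y) : Prop := exists Z, is_cone f Z /\ Q Z.

Definition is_hocolim (Y : nat -> C) (phi : forall i, hom (Y i) (Y i.+1)) L
    : Prop :=
  exists (S : C) (inj : forall i, hom (Y i) S) (d : hom S S),
    [/\ is_coproduct inj,
        forall i, d \oc inj i = inj i - inj i.+1 \oc phi i
      & is_cone d L].

Definition strongly_extension_closed Q : Prop :=
  (forall Z, is_zero Z -> Q Z) /\
  (forall (Y : nat -> C) (phi : forall i, hom (Y i) (Y i.+1)),
     Q (Y 0%N) -> (forall i, cone_in Q (phi i)) ->
     forall L, is_hocolim phi L -> Q L).

Definition strong_extension_closure P X : Prop :=
  forall Q, (forall Y, P Y -> Q Y) -> strongly_extension_closed Q ->
    closed_under_retracts Q -> closed_under_small_coproducts Q -> Q X.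

Definition naive_big_hull P L : Prop :=
  exists (Y : nat -> C) (phi : forall i, hom (Y i) (Y i.+1)),
    [/\ coproduct_closure P (Y 0%N),
        forall i, cone_in (coproduct_closure P) (phi i)
      & is_hocolim phi L].

Definition big_hull P X : Prop :=
  exists Y, naive_big_hull P Y /\ retract_of X Y.

(* The classes Q[1] and Q[-1], taken to be closed under isomorphism since
   [unsh] inverts [sh] only up to isomorphism. *)
Definition shift_class Q X : Prop := exists Y, Q Y /\ isomorphic X (sh Y).

Definition unshift_class Q X : Prop := exists Y, Q Y /\ isomorphic X (unsh Y).

(* P[-1] is contained in P; up to isomorphism, as P is merely a set. *)
Definition cosuspended P : Prop :=
  forall X, P X -> exists Y, P Y /\ isomorphic Y (unsh X).

Definition torsion_pair LO RO : Prop :=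
  [/\ forall X, right_orth LO X <-> RO X,
      forall X, LO X <-> left_orth RO X
    & forall M, exists L R (f : hom L M) (g : hom M R) (h : hom R (sh L)),
        [/\ dist f g h, LO L & RO R]].

(* [weight_structure W0 W1] : W0 is the class w <= 0 and W1 the class w >= 0. *)
Record weight_structure (W0 W1 : C -> Prop) : Prop := WeightStructure {
  weight_le_retract : closed_under_retracts W0;
  weight_ge_retract : closed_under_retracts W1;
  weight_le_shift : forall X, W0 X -> shift_class W0 X;
  weight_ge_shift : forall X, shift_class W1 X -> W1 X;
  weight_orth : forall X Y, W0 X -> shift_class W1 Y ->
    forall f : hom X Y, f = 0;
  weight_decomp : forall M,
    exists L R (f : hom L M) (g : hom M R) (h : hom R (sh L)),
      [/\ dist f g h, W0 L & shift_class W1 R]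
}.

Definition weighty_torsion_pair LO RO : Prop :=
  torsion_pair LO RO /\ weight_structure LO (unshift_class RO).

End Triangulated.

(* Main.v *)
From Stdlib Require Import IndefiniteDescription.
From mathcomp Require Import all_boot ssralg.
Require Import Defs.

Set Implicit Arguments.
Unset Strict Implicit.
Unset Printing Implicit Defensive.

Import GRing.Theory.
Local Open Scope ring_scope.

(** The heart of the matter is to decompose every object [M] in a triangle
    [L -> M -> R -> sh L] with [L] in the naive big hull of [P] and [R] right
    orthogonal to [P] (lemma [right_orth_decomposition]).  Starting with [M], one
    iterates [N_(k+1) := Cone (Q_k -> N_k)], where [Q_k] is a coproduct of objects
    of [P] through which every map from [P] to [N_k] factors; this uses that [P]
    is a set.  The transition maps [N_k -> N_(k+1)] are then [P]-null, and by the
    octahedral axiom the fibres [L_k] of [M -> N_k] form a sequence with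
    [L_0 = 0] and [Cone (L_k -> L_(k+1)) = Q_k].  Let [L] be its homotopy colimit,
    [L -> M] the induced map and [R] its cone.

    The coproduct of the triangles [L_k -> M -> N_k -> sh L_k] is distinguished
    ([coproduct_dist]), and the shift map of the coproduct of the [N_k] is
    [P]-null by countable perfection ([null_telescope]), so that its telescope
    [1 - shift] acts as the identity on maps from [P].  As [P] is cosuspended,
    every [X] in [P] is isomorphic to [sh Y] with [Y] in [P], so that the same is
    true for maps from [Y] and from [sh Y].  A chase that uses the split telescope of
    the constant sequence [M] ([constant_telescope]) now shows that maps from [X]
    to [M] lift to [L] and that maps from [Y] to [L] are determined by their
    composites with [L -> M]; hence all maps from [X] to [R] vanish.  The chase
    avoids identifying [R] with the homotopy colimit of the [N_k], for which the
    axioms only provide non-canonical maps between cones.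

    The rest is formal.  A left orthogonal class is strongly extension-closed
    ([left_orth_strongly_extension_closed]) and closed under retracts and
    coproducts, hence contains the closure of [P] as soon as it contains [P].  An
    object left orthogonal to all such [R] is a retract of its [L], so it belongs
    to the big hull.  The shift axioms of a weight structure follow from the
    stability of the right orthogonal under [sh]. *)

(** * Preadditive categories *)

Section Preadditive.

Variable C : preadditive.
Implicit Types (X Y Z S T : C) (P : C -> Prop).

Lemma comp0m X Y Z (f : hom X Y) : (0 : hom Y Z) \oc f = 0.
Proof. by apply: (addrI (0 \oc f)); rewrite -compDl !addr0. Qed.

Lemma compm0 X Y Z (g : hom Y Z) : g \oc (0 : hom X Y) = 0.
Proof. by apply: (addrI (g \oc 0)); rewrite -compDr !addr0. Qed.

Lemma compNm X Y Z (g : hom Y Z) (f : hom X Y) : (- g) \oc f = - (g \oc f).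
Proof. by apply: (addrI (g \oc f)); rewrite -compDl !subrr comp0m. Qed.

Lemma compmN X Y Z (g : hom Y Z) (f : hom X Y) : g \oc (- f) = - (g \oc f).
Proof. by apply: (addrI (g \oc f)); rewrite -compDr !subrr compm0. Qed.

Lemma compBl X Y Z (g g' : hom Y Z) (f : hom X Y) :
  (g - g') \oc f = g \oc f - g' \oc f.
Proof. by rewrite compDl compNm. Qed.

Lemma compBr X Y Z (g : hom Y Z) (f f' : hom X Y) :
  g \oc (f - f') = g \oc f - g \oc f'.
Proof. by rewrite compDr compmN. Qed.

Lemma is_iso_id X : is_iso (idm X).
Proof. by exists (idm X); rewrite comp1m. Qed.

Lemma is_iso_opp_id X : is_iso (- idm X).
Proof. by exists (- idm X); rewrite compNm compmN opprK comp1m. Qed.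

Lemma isomorphic_sym X Y : isomorphic X Y -> isomorphic Y X.
Proof. by move=> [f [g [gf fg]]]; exists g, f. Qed.

Lemma isomorphic_trans X Y Z :
  isomorphic X Y -> isomorphic Y Z -> isomorphic X Z.
Proof.
move=> [f [g [gf fg]]] [f' [g' [gf' fg']]]; exists (f' \oc f), (g \oc g').
split.
  by rewrite compA -(compA g g') gf' compm1.
by rewrite compA -(compA f' f) fg compm1.
Qed.

Lemma is_zero_id X : idm X = 0 -> is_zero X.
Proof.
move=> X0 Y; split=> f.
  by rewrite -(compm1 f) X0 compm0.
by rewrite -(comp1m f) X0 comp0m.
Qed.

Lemma coprod_desc (I : Type) (X : I -> C) S (inj : forall i, hom (X i) S) :
  is_coproduct inj -> forall T (f : forall i, hom (X i) T),
  exists h : hom S T, forall i, h \oc inj i = f i.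
Proof. by move=> cS T f; case: (cS T f) => h [hP _]; exists h. Qed.

Lemma coprod_ext (I : Type) (X : I -> C) S (inj : forall i, hom (X i) S) :
  is_coproduct inj -> forall T (g h : hom S T),
  (forall i, g \oc inj i = h \oc inj i) -> g = h.
Proof.
move=> cS T g h gh; case: (cS T (fun i => h \oc inj i)) => k [_ kP].
by rewrite -(kP g gh) -(kP h).
Qed.

Lemma isomorphic_right_orth P X Y :
  isomorphic X Y -> right_orth P Y -> right_orth P X.
Proof.
move=> [f [g [gf _]]] PY M PM h.
by rewrite -(comp1m h) -gf -compA (PY M PM (f \oc h)) compm0.
Qed.

Lemma retract_right_orth P : closed_under_retracts (right_orth P).
Proof.
move=> X Y [i [r ri]] PY M PM h.
by rewrite -(comp1m h) -ri -compA (PY M PM (i \oc h)) compm0.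
Qed.

Lemma retract_left_orth P : closed_under_retracts (left_orth P).
Proof.
move=> X Y [i [r ri]] PY M PM h.
by rewrite -(compm1 h) -ri compA (PY M PM (h \oc r)) comp0m.
Qed.

Lemma coproduct_left_orth P : closed_under_small_coproducts (left_orth P).
Proof.
move=> I X PX S inj cS M PM h; apply: (coprod_ext cS) => i.
by rewrite comp0m; apply: PX.
Qed.

(** A zero object is an empty coproduct. *)
Lemma zero_coproduct_closure P Z : is_zero Z -> coproduct_closure P Z.
Proof.
move=> Z0 Q _ Qcop.
apply: (Qcop False (fun i => match i return C with end) _ Z
          (fun i => match i with end)) => [[]|T f].
by exists 0; split=> [[]|h _]; rewrite (proj1 (Z0 T) h).
Qed.

(** Every object [M] receives a map from a coproduct of objects of [P] through
    which all maps from [P] to [M] factor: sum over all maps [F j -> M]. *)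
Lemma coproduct_precover P : has_small_coproducts C -> is_set_of_objects P ->
  forall M, exists Q (q : hom Q M), coproduct_closure P Q /\
    forall X, P X -> forall g : hom X M, exists k, q \oc k = g.
Proof.
move=> Cc [J [F FP]] M.
case: (Cc {j : J & hom (F j) M} (fun a => F (projT1 a))) => Q [inj cQ].
have [q qP] := coprod_desc cQ (fun a => projT2 a).
exists Q, q; split=> [R PR Rc|X PX g].
  by apply: (Rc _ _ _ _ _ cQ) => -[j g] /=; apply/PR/FP; exists j.
case/FP: PX => j Xj; subst X.
by exists (inj (existT _ j g)); apply: (qP (existT _ j g)).
Qed.

End Preadditive.

Section AdditiveFunctor.

Variables (C D : preadditive) (F : additive_functor C D).
Implicit Types X Y : C.

Lemma fmap0 X Y : fmap F (0 : hom X Y) = 0.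
Proof. by apply: (addrI (fmap F (0 : hom X Y))); rewrite -fmapD !addr0. Qed.

Lemma fmapN X Y (f : hom X Y) : fmap F (- f) = - fmap F f.
Proof. by apply: (addrI (fmap F f)); rewrite -fmapD !subrr fmap0. Qed.

Lemma fmapB X Y (f g : hom X Y) : fmap F (f - g) = fmap F f - fmap F g.
Proof. by rewrite fmapD fmapN. Qed.

Lemma fmap_iso X Y (f : hom X Y) : is_iso f -> is_iso (fmap F f).
Proof. by move=> [g [gf fg]]; exists (fmap F g); rewrite -!fmapM gf fg !fmap1. Qed.

Lemma fmap_isomorphic X Y : isomorphic X Y -> isomorphic (F X) (F Y).
Proof. by move=> [f /fmap_iso fi]; exists (fmap F f). Qed.

Lemma fmap_zero X : is_zero X -> is_zero (F X).
Proof.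
by move=> X0; apply: is_zero_id; rewrite -fmap1 (proj1 (X0 X) (idm X)) fmap0.
Qed.

(** No compatibility between the two natural isomorphisms of an equivalence is
    needed for faithfulness and fullness. *)
Lemma faithful_of_retraction (G : additive_functor D C) :
  comp_iso_id G F -> forall X Y (f g : hom X Y), fmap F f = fmap F g -> f = g.
Proof.
move=> [e [ei en]] X Y f g fg; case: (ei X) => e' [_ ee'].
by rewrite -(compm1 f) -(compm1 g) -ee' !compA !en fg.
Qed.

End AdditiveFunctor.

Lemma full_of_equivalence (C D : preadditive) (F : additive_functor C D)
    (G : additive_functor D C) : comp_iso_id G F -> comp_iso_id F G ->
  forall X Y (g : hom (F X) (F Y)), exists f, fmap F f = g.
Proof.
move=> GF FG X Y g; have [e [ei en]] := GF.
case: (ei X) => e' [e'e ee']; case: (ei Y) => e1' [e1e ee1].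
exists (e Y \oc fmap G g \oc e'); apply: (faithful_of_retraction FG).
set h := _ \oc e'; have : h \oc e X = e Y \oc fmap G g.
  by rewrite /h -compA e'e compm1.
rewrite en => /(congr1 (fun z => e1' \oc z)).
by rewrite !compA e1e !comp1m.
Qed.

(** * Exactness of distinguished triangles *)

Section Triangulated.

Variable C : triangulated.
Implicit Types (X Y Z T : C) (P Q : C -> Prop).

Lemma sh_faithful X Y (f g : hom X Y) : fmap sh f = fmap sh g -> f = g.
Proof. exact: faithful_of_retraction (shK C) _ _ f g. Qed.

Lemma sh_full X Y (g : hom (sh X) (sh Y)) : exists f, fmap sh f = g.
Proof. exact: (full_of_equivalence (shK C) (unshK C)). Qed.

Lemma sh_unsh X : isomorphic (sh (unsh X)) X.
Proof. by case: (unshK C) => e [ei _]; exists (e X). Qed.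

Lemma unsh_sh X : isomorphic (unsh (sh X)) X.
Proof. by case: (shK C) => e [ei _]; exists (e X). Qed.

Lemma sh_reflect_iso X Y (f : hom X Y) : is_iso (fmap sh f) -> is_iso f.
Proof.
move=> [g [gf fg]]; case: (sh_full g) => g' g'E; exists g'.
by split; apply: sh_faithful; rewrite fmapM g'E fmap1.
Qed.

Section Exactness.

Variables (X Y Z : C) (u : hom X Y) (v : hom Y Z) (w : hom Z (sh X)).
Hypothesis uvw : dist u v w.

Lemma dist_comp0 : v \oc u = 0.
Proof.
case: (tri_additive C) => -[O O0] _.
case: (dist_fill (dist_id X O0) uvw (f := idm X) (g := u)) => // h [hv _].
by rewrite -hv compm0.
Qed.

Lemma dist_lift T (g : hom T Y) : v \oc g = 0 -> exists f, u \oc f = g.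
Proof.
case: (tri_additive C) => -[O O0] _ vg.
have dT := (dist_rotate _ _ _).1 (dist_id T O0).
have dR := (dist_rotate _ _ _).1 uvw.
case: (dist_fill dT dR (f := g) (g := 0)) => [|h [_]].
  by rewrite compm0 vg.
case: (sh_full h) => f <-; rewrite fmap1 compmN compm1 compNm => /oppr_inj.
by rewrite -fmapM => /sh_faithful gE; exists f.
Qed.

Lemma dist_extend T (g : hom Y T) : g \oc u = 0 -> exists f, f \oc v = g.
Proof.
case: (tri_additive C) => -[O O0] _ gu.
have dT : dist (0 : hom O T) (idm T) (0 : hom T (sh O)).
  by apply/dist_rotate; rewrite fmap0 oppr0; apply/dist_id/fmap_zero.
case: (dist_fill uvw dT (f := 0) (g := g)) => [|h [hv _]].
  by rewrite comp0m gu.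
by exists h; rewrite hv comp1m.
Qed.

End Exactness.

Section ExactnessRotated.

Variables (X Y Z : C) (u : hom X Y) (v : hom Y Z) (w : hom Z (sh X)).
Hypothesis uvw : dist u v w.

Let vwu : dist v w (- fmap sh u) := (dist_rotate _ _ _).1 uvw.
Let wuv : dist w (- fmap sh u) (- fmap sh v) := (dist_rotate _ _ _).1 vwu.

Lemma dist_comp0_sh : fmap sh u \oc w = 0.
Proof. by apply: oppr_inj; rewrite -compNm (dist_comp0 wuv) oppr0. Qed.

Lemma dist_lift_third T (g : hom T Z) : w \oc g = 0 -> exists f, v \oc f = g.
Proof. exact: dist_lift vwu T g. Qed.

Lemma dist_lift_sh T (g : hom T (sh X)) :
  fmap sh u \oc g = 0 -> exists f, w \oc f = g.
Proof. by move=> ug; apply: (dist_lift wuv); rewrite compNm ug oppr0. Qed.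

Lemma dist_extend_third T (g : hom Z T) : g \oc v = 0 -> exists f, f \oc w = g.
Proof. exact: dist_extend vwu T g. Qed.

Lemma dist_extend_sh T (g : hom (sh X) T) :
  g \oc w = 0 -> exists f, f \oc fmap sh u = g.
Proof.
move=> /(dist_extend wuv)[f fg].
by exists (- f); rewrite compNm -compmN.
Qed.

Lemma dist_sh : dist (fmap sh u) (fmap sh v) (- fmap sh w).
Proof.
have uvw1 := (dist_rotate _ _ _).1 wuv.
apply: (dist_iso (is_iso_id _) (is_iso_opp_id _) (is_iso_id _) _ _ _ uvw1).
- by rewrite compNm comp1m opprK compm1.
- by rewrite comp1m compmN compm1.
by rewrite fmap1 comp1m compm1.
Qed.

(** The five lemma: the comparison map [h] from a candidate triangle on [u],
    exact under all functors [hom _ T], to a distinguished one is invertible. *)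
Lemma exact_is_iso Z' (v' : hom Y Z') (w' : hom Z' (sh X)) (h : hom Z' Z) :
    h \oc v' = v -> w \oc h = w' -> v' \oc u = 0 ->
    (forall T (t : hom Z' T), t \oc v' = 0 -> exists s, s \oc w' = t) ->
    (forall T (s : hom (sh X) T), s \oc w' = 0 ->
       exists r, r \oc fmap sh u = s) ->
  is_iso h.
Proof.
move=> hv wh vu exZ exX.
have h_epi T (t : hom Z T) : t \oc h = 0 -> t = 0.
  move=> th; have [|s sE] := dist_extend_third (g := t).
    by rewrite -hv compA th comp0m.
  have [|r rE] := exX T s; first by rewrite -wh compA sE.
  by rewrite -sE -rE -compA dist_comp0_sh compm0.
have h_split : exists k, k \oc h = idm Z'.
  have [s sE] := dist_extend uvw vu.
  have [|r rE] := exZ Z' (idm Z' - s \oc h).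
    by rewrite compBl comp1m -compA hv sE subrr.
  by exists (s + r \oc w); rewrite compDl -(compA r) wh rE addrC subrK.
case: h_split => k kh; exists k; split=> //; apply/eqP.
rewrite -subr_eq0; apply/eqP/h_epi.
by rewrite compBl -compA kh compm1 comp1m subrr.
Qed.

End ExactnessRotated.

Lemma cone_isomorphic X Y (u : hom X Y) Z Z' :
  is_cone u Z -> is_cone u Z' -> isomorphic Z Z'.
Proof.
move=> [v [w d]] [v' [w' d']].
have [|h [hv hw]] := dist_fill d d' (f := idm X) (g := idm Y).
  by rewrite comp1m compm1.
exists h; apply: (exact_is_iso d' (v' := v) (w' := w)).
- by rewrite hv compm1.
- by rewrite -hw fmap1 comp1m.
- exact: dist_comp0 d.
- by move=> T t; apply: dist_extend_third d T t.
by move=> T s; apply: dist_extend_sh d T s.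
Qed.

Lemma isomorphic_is_cone X Y (u : hom X Y) Z Z' :
  isomorphic Z Z' -> is_cone u Z -> is_cone u Z'.
Proof.
move=> [h hi] [v [w d]]; have [k [kh hk]] := hi.
exists (h \oc v), (w \oc k).
apply: (dist_iso (is_iso_id _) (is_iso_id _) hi _ _ _ d).
- by rewrite comp1m compm1.
- by rewrite compm1.
by rewrite fmap1 comp1m -compA kh compm1.
Qed.

Lemma is_cone_unshift X Y (u : hom X Y) Z :
  is_cone (fmap sh u) (sh Z) -> is_cone u Z.
Proof.
move=> cZ; case: (dist_complete u) => Z' [v [w d]].
have cZ' : is_cone (fmap sh u) (sh Z').
  by exists (fmap sh v), (- fmap sh w); apply: dist_sh d.
case: (cone_isomorphic cZ' cZ) => h hi; case: (sh_full h) => k kh.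
have : is_iso k by apply: sh_reflect_iso; rewrite kh.
by move=> ki; apply: isomorphic_is_cone (ex_intro _ v (ex_intro _ w d)); exists k.
Qed.

Lemma dist_complete_left Y Z (v : hom Y Z) :
  exists X (u : hom X Y) (w : hom Z (sh X)), dist u v w.
Proof.
case: (dist_complete v) => W [a [b d]].
have [e [k [ke ek]]] := sh_unsh W; have ki : is_iso k by exists e.
case: (sh_full (- (b \oc e))) => u uE.
exists (unsh W), u, (k \oc a); apply/dist_rotate; rewrite uE opprK.
apply: (dist_iso (is_iso_id _) (is_iso_id _) ki _ _ _ d).
- by rewrite comp1m compm1.
- by rewrite compm1.
by rewrite fmap1 comp1m -compA ek compm1.
Qed.

(** * Coproducts of triangles and homotopy colimits *)

Lemma sh_coproduct (I : Type) (X : I -> C) S (inj : forall i, hom (X i) S) :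
  is_coproduct inj -> is_coproduct (fun i => fmap sh (inj i)).
Proof.
move=> cS T f; case: (sh_unsh T) => e [k [ke ek]].
have eK Z (g : hom Z T) : e \oc (k \oc g) = g by rewrite compA ek comp1m.
pose f' i := constructive_indefinite_description _ (sh_full (k \oc f i)).
have [h hE] := coprod_desc cS (fun i => proj1_sig (f' i)).
exists (e \oc fmap sh h); split=> [i|g gE].
  by rewrite -compA -fmapM hE (proj2_sig (f' i)) eK.
case: (sh_full (k \oc g)) => g' g'E.
rewrite -(eK _ g) -g'E; congr (e \oc fmap sh _); apply: (coprod_ext cS) => i.
apply: sh_faithful; rewrite !fmapM g'E -compA gE -fmapM hE.
by rewrite (proj2_sig (f' i)).
Qed.

Lemma coproduct_dist (I : Type) (X Y Z : I -> C)
    (u : forall i, hom (X i) (Y i)) (v : forall i, hom (Y i) (Z i))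
    (w : forall i, hom (Z i) (sh (X i)))
    (SX SY SZ : C) (iX : forall i, hom (X i) SX) (iY : forall i, hom (Y i) SY)
    (iZ : forall i, hom (Z i) SZ)
    (U : hom SX SY) (V : hom SY SZ) (W : hom SZ (sh SX)) :
    is_coproduct iX -> is_coproduct iY -> is_coproduct iZ ->
    (forall i, U \oc iX i = iY i \oc u i) ->
    (forall i, V \oc iY i = iZ i \oc v i) ->
    (forall i, W \oc iZ i = fmap sh (iX i) \oc w i) ->
    (forall i, dist (u i) (v i) (w i)) ->
  dist U V W.
Proof.
move=> cX cY cZ UE VE WE d.
have shX := sh_coproduct cX; have shY := sh_coproduct cY.
case: (dist_complete U) => Z0 [v0 [w0 d0]].
have fill i : exists h, h \oc v i = v0 \oc iY i /\ fmap sh (iX i) \oc w i = w0 \oc h.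
  by apply: (dist_fill (d i) d0); rewrite UE.
pose h' i := constructive_indefinite_description _ (fill i).
have [h hE] := coprod_desc cZ (fun i => proj1_sig (h' i)).
have hV : h \oc V = v0.
  apply: (coprod_ext cY) => i; rewrite -compA VE compA hE.
  by case: (proj2_sig (h' i)).
have wh : w0 \oc h = W.
  apply: (coprod_ext cZ) => i; rewrite -compA hE WE.
  by case: (proj2_sig (h' i)).
have hi : is_iso h.
  apply: (exact_is_iso d0 hV wh).
  - apply: (coprod_ext cX) => i; rewrite comp0m -compA UE compA VE -compA.
    by rewrite (dist_comp0 (d i)) compm0.
  - move=> T t tV.
    have ex i : exists s, s \oc w i = t \oc iZ i.
      apply: (dist_extend_third (d i)).
      by rewrite -compA -VE compA tV comp0m.
    pose s' i := constructive_indefinite_description _ (ex i).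
    have [s sE] := coprod_desc shX (fun i => proj1_sig (s' i)).
    exists s; apply: (coprod_ext cZ) => i.
    by rewrite -compA WE compA sE (proj2_sig (s' i)).
  move=> T s sW.
  have ex i : exists r, r \oc fmap sh (u i) = s \oc fmap sh (iX i).
    apply: (dist_extend_sh (d i)).
    by rewrite -compA -WE compA sW comp0m.
  pose r' i := constructive_indefinite_description _ (ex i).
  have [r rE] := coprod_desc shY (fun i => proj1_sig (r' i)).
  exists r; apply: (coprod_ext shX) => i.
  by rewrite -compA -fmapM UE fmapM compA rE (proj2_sig (r' i)).
have [k [kh hk]] := hi; have ki : is_iso k by exists h.
apply: (dist_iso (is_iso_id _) (is_iso_id _) ki _ _ _ d0).
- by rewrite comp1m compm1.
- by rewrite -hV compA kh comp1m compm1.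
by rewrite fmap1 comp1m -wh -compA hk compm1.
Qed.

(** A map out of the homotopy colimit that vanishes on
    the [Y i] comes from the shifted coproduct, and there the telescope acts
    surjectively because [hom (sh (Y i)) R] receives a surjection from
    [hom (sh (Y i.+1)) R]. *)
Lemma left_orth_strongly_extension_closed Q :
  strongly_extension_closed (left_orth Q).
Proof.
split=> [Z Z0 R _ f|Y phi Y0 cY L [S [inj [d [cS dE [v [w dL]]]]]] R QR g].
  exact: (proj1 (Z0 R)).
have oY i : left_orth Q (Y i).
  elim: i => // i IH T QT f.
  have [K [[a [b dK]] oK]] := cY i.
  have [k <-] := dist_extend dK (IH T QT (f \oc phi i)).
  by rewrite (oK T QT k) comp0m.
have [s <-] : exists s, s \oc w = g.
  apply: (dist_extend_third dL); apply: (coprod_ext cS) => i.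
  by rewrite comp0m; apply: oY.
have ext i (x : hom (sh (Y i)) R) : exists y, y \oc fmap sh (phi i) = x.
  have [K [[a [b dK]] oK]] := cY i.
  by apply: (dist_extend_sh dK); apply: oK.
pose e i x := constructive_indefinite_description _ (ext i x).
pose t := nat_rect (fun i => hom (sh (Y i)) R : Type) 0
  (fun i ti => proj1_sig (e i (ti - s \oc fmap sh (inj i)))).
have tE i : t i.+1 \oc fmap sh (phi i) = t i - s \oc fmap sh (inj i).
  exact: (proj2_sig (e i (t i - s \oc fmap sh (inj i)))).
have [r rE] := coprod_desc (sh_coproduct cS) t.
have <- : r \oc fmap sh d = s.
  apply: (coprod_ext (sh_coproduct cS)) => i.
  rewrite -compA -fmapM dE fmapB fmapM compBr compA !rE tE.
  by rewrite opprB addrC subrK.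
by rewrite -compA (dist_comp0_sh dL) compm0.
Qed.

(** * The approximating tower *)

(** A stage of the tower over [M]: a triangle [L -> M -> N -> sh L]. *)
Record stage (M : C) := Stage {
  st_left : C;
  st_right : C;
  st_in : hom st_left M;
  st_out : hom M st_right;
  st_bd : hom st_right (sh st_left);
  st_dist : dist st_in st_out st_bd
}.

(** One step of the tower: a morphism of stages that is the identity on [M], is
    [P]-null on the right and has its left cone in the coproducts of [P]. *)
Definition stage_step P (M : C) (s s' : stage M) : Prop :=
  exists (l : hom (st_left s) (st_left s')) (n : hom (st_right s) (st_right s')),
    [/\ null P n, cone_in (coproduct_closure P) l, st_in s' \oc l = st_in s,
        n \oc st_out s = st_out s'
      & fmap sh l \oc st_bd s = st_bd s' \oc n].

Lemma stage_step_exists P (M : C) (s : stage M) :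
  has_small_coproducts C -> is_set_of_objects P ->
  exists s', stage_step P s s'.
Proof.
move=> Cc Pset; case: s => L N i th bd d.
have [Q [q [PQ qP]]] := coproduct_precover Cc Pset N.
have [N' [n [om dn]]] := dist_complete q.
have [L' [i' [bd' d']]] := dist_complete_left (n \oc th).
have [f [g [dfg fbd fi _ _]]] := dist_octahedron
  ((dist_rotate _ _ _).1 d) ((dist_rotate _ _ _).1 dn)
  ((dist_rotate _ _ _).1 d').
have [l lE] := sh_full f; subst f.
exists (Stage d'), l, n; split=> //=.
- move=> X PX x; have [k <-] := qP X PX x.
  by rewrite compA (dist_comp0 dn) comp0m.
- exists Q; split=> //; apply: is_cone_unshift.
  by exists g, (fmap sh bd \oc (- fmap sh q)).
by apply: sh_faithful; rewrite fmapM; apply: oppr_inj; rewrite -compNm.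
Qed.

Lemma tower_exists P (M : C) :
  has_small_coproducts C -> is_set_of_objects P ->
  exists s : nat -> stage M,
    is_zero (st_left (s 0%N)) /\ forall k, stage_step P (s k) (s k.+1).
Proof.
move=> Cc Pset; have [[O O0] _] := tri_additive C.
have d0 : dist (0 : hom O M) (idm M) (0 : hom M (sh O)).
  by apply/dist_rotate; rewrite fmap0 oppr0; apply/dist_id/fmap_zero.
pose next s := constructive_indefinite_description _
  (@stage_step_exists P M s Cc Pset).
exists (fun k => iter k (fun s => proj1_sig (next s)) (Stage d0)).
by split=> // k; apply: (proj2_sig (next _)).
Qed.

(** * The torsion decomposition *)

Lemma null_comp P X Y Z (h : hom X Y) (g : hom Y Z) :
  null P h -> null P (g \oc h).
Proof. by move=> hP M PM x; rewrite -compA hP // compm0. Qed.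

Lemma null_comp_sh0 P X Y Y' (h : hom X Y) (g : hom (sh Y') X) T :
  isomorphic (sh Y') T -> P T -> null P h -> h \oc g = 0.
Proof.
move=> [e [k [ke _]]] PT hP.
by rewrite -(compm1 g) -ke !compA -(compA h g k) hP // comp0m.
Qed.

(** The telescope of a constant sequence splits: [1 - tau] has a retraction [r],
    and [(1 - tau) \oc r] is the projection onto the kernel of the codiagonal
    [c] along the zeroth summand. *)
Lemma constant_telescope (M S : C) (inj : nat -> hom M S)
    (tau : hom S S) (c : hom S M) :
    is_coproduct inj -> (forall k, tau \oc inj k = inj k.+1) ->
    (forall k, c \oc inj k = idm M) ->
  exists r : hom S S, r \oc (idm S - tau) = idm S /\
    (idm S - tau) \oc r = idm S - inj 0%N \oc c.
Proof.
move=> cS tauE cE.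
have [r rE] := coprod_desc cS (fun k => - \sum_(j < k) inj j).
exists r; split; apply: (coprod_ext cS) => k.
  rewrite -compA compBl tauE comp1m compBr !rE big_ord_recr /= opprK.
  by rewrite addrA addNr add0r.
rewrite -compA rE [RHS]compBl comp1m -compA cE compm1.
elim: k => [|k IHk]; first by rewrite big_ord0 oppr0 compm0 subrr.
rewrite big_ord_recr /= opprD compDr IHk compmN compBl tauE comp1m opprB.
by rewrite addrC addrA subrK.
Qed.

Section Decomposition.

Variable P : C -> Prop.
Hypothesis C_coproducts : has_small_coproducts C.
Hypothesis P_perfect : countably_perfect P.
Hypothesis P_cosuspended : cosuspended P.

Lemma cosuspended_sh X : P X -> exists2 Y, P Y & isomorphic (sh Y) X.
Proof.
move=> /P_cosuspended[Y [PY /(fmap_isomorphic sh) YX]]; exists Y => //.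
exact: isomorphic_trans YX (sh_unsh X).
Qed.

(** The shift map of a sequence of null morphisms is the coproduct of these
    morphisms followed by an inclusion of coproducts. *)
Lemma null_telescope (N : nat -> C) (n : forall k, hom (N k) (N k.+1)) S
    (inj : forall k, hom (N k) S) (H : hom S S) :
  is_coproduct inj -> (forall k, null P (n k)) ->
  (forall k, H \oc inj k = inj k.+1 \oc n k) -> null P H.
Proof.
move=> cS nP HE; case: (C_coproducts (fun k => N k.+1)) => S' [inj' cS'].
have [a aE] := coprod_desc cS (fun k => inj' k \oc n k).
have [b bE] := coprod_desc cS' (fun k => inj k.+1).
have <- : b \oc a = H.
  by apply: (coprod_ext cS) => k; rewrite -compA aE compA bE HE.
exact/null_comp/(P_perfect nP cS cS' aE).
Qed.

(** [L] is the homotopy colimit of the left parts of the tower.  The triangle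
    [SL -> SM -> SN -> sh SL] is the coproduct of the stages; [dL], [tau] and
    [dN] are the shift maps of its terms, and [dN] is [P]-null.  The chase shows
    that [f : L -> M] is surjective on maps from [P] and that [sh f] is injective
    on them. *)
Lemma right_orth_decomposition (P_set : is_set_of_objects P) (M : C) :
  exists L R (f : hom L M) (g : hom M R) (h : hom R (sh L)),
    [/\ dist f g h, naive_big_hull P L & right_orth P R].
Proof.
have [s [s0 step]] := tower_exists M C_coproducts P_set.
pose Lk k := st_left (s k); pose Nk k := st_right (s k).
have ex k : exists ln : hom (Lk k) (Lk k.+1) * hom (Nk k) (Nk k.+1),
    [/\ null P ln.2, cone_in (coproduct_closure P) ln.1,
        st_in (s k.+1) \oc ln.1 = st_in (s k),
        ln.2 \oc st_out (s k) = st_out (s k.+1)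
      & fmap sh ln.1 \oc st_bd (s k) = st_bd (s k.+1) \oc ln.2].
  by have [l [n H]] := step k; exists (l, n).
pose ln k := constructive_indefinite_description _ (ex k).
pose l k := (proj1_sig (ln k)).1; pose n k := (proj1_sig (ln k)).2.
have nP k : null P (n k) by case: (proj2_sig (ln k)).
have lC k : cone_in (coproduct_closure P) (l k) by case: (proj2_sig (ln k)).
have lin k : st_in (s k.+1) \oc l k = st_in (s k) by case: (proj2_sig (ln k)).
have nout k : n k \oc st_out (s k) = st_out (s k.+1) by case: (proj2_sig (ln k)).
have lnbd k : fmap sh (l k) \oc st_bd (s k) = st_bd (s k.+1) \oc n k.
  by case: (proj2_sig (ln k)).
have [SL [iL cL]] := C_coproducts Lk.
have [SM [iM cM]] := C_coproducts (fun _ : nat => M).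
have [SN [iN cN]] := C_coproducts Nk.
have [I IE] := coprod_desc cL (fun k => iM k \oc st_in (s k)).
have [Th ThE] := coprod_desc cM (fun k => iN k \oc st_out (s k)).
have [D DE] := coprod_desc cN (fun k => fmap sh (iL k) \oc st_bd (s k)).
have dS : dist I Th D.
  exact: (coproduct_dist cL cM cN IE ThE DE (fun k => st_dist (s k))).
have [dL dLE] := coprod_desc cL (fun k => iL k.+1 \oc l k).
have [tau tauE] := coprod_desc cM (fun k => iM k.+1).
have [dN dNE] := coprod_desc cN (fun k => iN k.+1 \oc n k).
have [c cE] := coprod_desc cM (fun _ => idm M).
have IdL : I \oc dL = tau \oc I.
  apply: (coprod_ext cL) => k.
  by rewrite -!compA dLE IE !compA IE tauE -compA lin.
have ItauL : I \oc (idm SL - dL) = (idm SM - tau) \oc I.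
  by rewrite compBr compBl compm1 comp1m IdL.
have Thtau : Th \oc tau = dN \oc Th.
  apply: (coprod_ext cM) => k.
  by rewrite -!compA tauE !ThE compA dNE -compA nout.
have DdN : fmap sh dL \oc D = D \oc dN.
  apply: (coprod_ext cN) => k.
  rewrite -!compA DE dNE !compA DE -fmapM dLE fmapM.
  by rewrite -!compA lnbd.
have dNP : null P dN := null_telescope cN nP dNE.
have [r [rK Kr]] := constant_telescope cM tauE cE.
have ctau : c \oc tau = c.
  by apply: (coprod_ext cM) => k; rewrite -compA tauE !cE.
have [L [pi [ka dpi]]] := dist_complete (idm SL - dL).
have [f fpi] : exists f, f \oc pi = c \oc I.
  apply: (dist_extend dpi).
  by rewrite -compA ItauL compA compBr compm1 ctau subrr comp0m.
have [R [g [h d]]] := dist_complete f.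
exists L, R, f, g, h; split=> //.
  exists Lk, l; split=> //; first exact: zero_coproduct_closure.
  exists SL, iL, (idm SL - dL); split=> //; last by exists pi, ka.
  by move=> k; rewrite compBl comp1m dLE.
move=> X PX x.
have surj (z : hom X M) : exists y, f \oc y = z.
  have [|y yE] := dist_lift (st_dist (s 1%N)) (g := z).
    by rewrite -nout -compA nP.
  exists (pi \oc (iL 1%N \oc y)).
  by rewrite !compA fpi -(compA c) IE !compA cE comp1m.
suff hx : h \oc x = 0.
  have [z <-] := dist_lift_third d hx; have [y <-] := surj z.
  by rewrite compA (dist_comp0 d) comp0m.
have [Y PY YX] := cosuspended_sh PX; have [e [k [ke ek]]] := YX.
have [y yE] := sh_full (h \oc x \oc e).
suff y0 : y = 0.
  by rewrite -(compm1 (h \oc x)) -ek compA -yE y0 fmap0 comp0m.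
have fy : f \oc y = 0.
  by apply: sh_faithful; rewrite fmapM yE fmap0 !compA (dist_comp0_sh d) !comp0m.
(* A map [a : Y -> sh SL] killed by the telescope factors as [D \oc b], on
   which the telescope is the identity. *)
have telY (a : hom Y (sh SL)) : fmap sh (idm SL - dL) \oc a = 0 -> a = 0.
  move=> a0; have [b bE] : exists b, D \oc b = a.
    apply: (dist_lift_sh dS).
    have : fmap sh (idm SM - tau) \oc (fmap sh I \oc a) = 0.
      by rewrite compA -fmapM -ItauL fmapM -compA a0 compm0.
    move=> /(congr1 (fun t => fmap sh r \oc t)).
    by rewrite compA -fmapM rK fmap1 comp1m compm0.
  move: a0; rewrite fmapB fmap1 compBl comp1m -bE compA DdN -compA dNP //.
  by rewrite compm0 subr0.
have [a aE] : exists a, pi \oc a = y.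
  apply: (dist_lift_third dpi); apply: telY.
  by rewrite compA (dist_comp0_sh dpi) comp0m.
have ca : c \oc (I \oc a) = 0 by rewrite compA -fpi -compA aE.
have Kra : (idm SM - tau) \oc (r \oc (I \oc a)) = I \oc a.
  by rewrite compA Kr compBl comp1m -compA ca compm0 subr0.
have [b bE] : exists b, I \oc b = r \oc (I \oc a).
  apply: (dist_lift dS).
  have : Th \oc ((idm SM - tau) \oc (r \oc (I \oc a))) = 0.
    by rewrite Kra compA (dist_comp0 dS) comp0m.
  rewrite compBl comp1m compBr (compA _ tau) Thtau -(compA dN) dNP //.
  by rewrite subr0.
(* Although [I \oc a'] vanishes, [a'] need not; but [sh a'] factors through [D],
   which makes the shift map kill it. *)
pose a' := a - (idm SL - dL) \oc b.
have Ia' : I \oc a' = 0.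
  by rewrite /a' compBr compA ItauL -compA bE Kra subrr.
have dLa' : dL \oc a' = 0.
  apply: sh_faithful; have [b' b'E] : exists b', D \oc b' = fmap sh a'.
    by apply: (dist_lift_sh dS); rewrite -fmapM Ia' fmap0.
  rewrite fmapM -b'E compA DdN -compA.
  by rewrite (null_comp_sh0 b' YX PX dNP) compm0 fmap0.
have -> : y = pi \oc ((idm SL - dL) \oc (a' + b)).
  rewrite compDr (compBl _ _ a') comp1m dLa' subr0 /a' subrK.
  by rewrite aE.
by rewrite compA (dist_comp0 dpi) comp0m.
Qed.

End Decomposition.

(** * Hulls, orthogonals and shifts *)

Lemma left_orth_right_orth_closure P X :
  strong_extension_closure P X -> left_orth (right_orth P) X.
Proof.
apply.
- by move=> Y PY R PR h; apply: PR.
- exact: left_orth_strongly_extension_closed.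
- exact: retract_left_orth.
exact: coproduct_left_orth.
Qed.

Lemma big_hull_closure P X : big_hull P X -> strong_extension_closure P X.
Proof.
move=> [Y [[Z [phi [Z0 cZ LY]]] XY]] Q PQ Qext Qretr Qcop.
apply: Qretr XY _; apply: (Qext.2 Z phi _ _ Y LY); first exact: Z0.
by move=> i; have [K [cK PK]] := cZ i; exists K; split=> //; apply: PK.
Qed.

Lemma right_orth_sh P X :
  cosuspended P -> right_orth P X -> right_orth P (sh X).
Proof.
move=> Pc PX M PM g; have [Y PY [e [k [_ ek]]]] := cosuspended_sh Pc PM.
have [y yE] := sh_full (g \oc e).
by rewrite -(compm1 g) -ek compA -yE (PX Y PY y) fmap0 comp0m.
Qed.

Lemma left_orth_unsh Q X :
  (forall Y, Q Y -> Q (sh Y)) -> left_orth Q X -> left_orth Q (unsh X).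
Proof.
move=> Qsh QX R QR g; have [e [k [ke _]]] := sh_unsh X.
apply: sh_faithful; rewrite fmap0 -(compm1 (fmap sh g)) -ke compA.
by rewrite (QX _ (Qsh _ QR) (fmap sh g \oc k)) comp0m.
Qed.

Lemma left_orth_retract Q L R X (f : hom L X) (g : hom X R)
    (h : hom R (sh L)) :
  dist f g h -> Q R -> left_orth Q X -> retract_of X L.
Proof.
move=> d QR QX; have [|s sE] := dist_lift d (g := idm X).
  by rewrite compm1; apply: QX.
by exists s, f.
Qed.

(** A torsion pair whose right class is stable under the shift is weighty. *)
Lemma weighty_of_torsion_pair (LO RO : C -> Prop) :
  torsion_pair LO RO -> (forall X, RO X -> RO (sh X)) ->
  weighty_torsion_pair LO RO.
Proof.
move=> tp ROsh; split=> //; have [ro lo dec] := tp.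
have ROiso X Y : isomorphic X Y -> RO Y -> RO X.
  by move=> XY /ro RY; apply/ro; apply: isomorphic_right_orth XY RY.
split.
- move=> X Y XY /lo LY; apply/lo; apply: retract_left_orth XY LY.
- move=> X Y [i [r ri]] [Z [RZ YZ]].
  exists (sh X); split; last exact/isomorphic_sym/unsh_sh.
  have YR : RO (sh Y).
    exact: ROiso (isomorphic_trans (fmap_isomorphic sh YZ) (sh_unsh Z)) RZ.
  apply/ro; apply: (@retract_right_orth _ _ _ (sh Y)); last exact/ro.
  by exists (fmap sh i), (fmap sh r); rewrite -fmapM ri fmap1.
- move=> X /lo LX; exists (unsh X); split; last exact/isomorphic_sym/sh_unsh.
  exact/lo/left_orth_unsh.
- move=> X [Y [[Z [RZ YZ]] XY]].
  exists (sh X); split; last exact/isomorphic_sym/unsh_sh.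
  apply/ROsh/(ROiso _ _ _ RZ)/(isomorphic_trans XY).
  exact: isomorphic_trans (fmap_isomorphic sh YZ) (sh_unsh Z).
- move=> X Y /lo LX [Y' [[Z [RZ YZ]] YY']] f; apply: (LX Y).
  apply: (ROiso _ _ _ RZ); apply: (isomorphic_trans YY').
  exact: isomorphic_trans (fmap_isomorphic sh YZ) (sh_unsh Z).
move=> M; have [L [R [f [g [h [d LL RR]]]]]] := dec M.
exists L, R, f, g, h; split=> //; exists (unsh R).
split; last exact/isomorphic_sym/sh_unsh.
by exists R; split=> //; exists (idm _); apply: is_iso_id.
Qed.

End Triangulated.

Theorem theorem4p3p1 (C : triangulated) (P : C -> Prop)
    (C_coproducts : has_small_coproducts C)
    (P_set : is_set_of_objects P)
    (P_perfect : countably_perfect P)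
    (P_cosuspended : cosuspended P) :
  weighty_torsion_pair (strong_extension_closure P) (right_orth P) /\
  (forall X : C, strong_extension_closure P X <-> big_hull P X).
Proof.
have dec := right_orth_decomposition C_coproducts P_perfect P_cosuspended P_set.
have hull X : left_orth (right_orth P) X -> big_hull P X.
  move=> LX; have [L [R [f [g [h [d hL PR]]]]]] := dec X.
  by exists L; split=> //; apply: left_orth_retract d PR LX.
have closureE X : strong_extension_closure P X <-> big_hull P X.
  split; last exact: big_hull_closure.
  by move=> /left_orth_right_orth_closure; apply: hull.
split=> //; apply: weighty_of_torsion_pair; last first.
  by move=> X; apply: right_orth_sh.
split.
- move=> X; split=> [LX M PM f|PX M LM f].
    by apply: (LX M) => Q PQ _ _ _; apply: PQ.
  exact: (left_orth_right_orth_closure LM PX).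
- move=> X; split; first exact: left_orth_right_orth_closure.
  by move=> /hull/closureE.
move=> M; have [L [R [f [g [h [d hL PR]]]]]] := dec M.
exists L, R, f, g, h; split=> //; apply/closureE; exists L; split=> //.
by exists (idm L), (idm L); rewrite comp1m.
Qed.
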